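(* Let $n\ge m$ be positive integers, let $f:\mathbb{R}^{m\times n}\to\mathbb{R}$ be proper and $L$-smooth for some $L>0$, have a unique global minimizer $x^*$, and satisfy a global Polyak-Łojasiewicz inequality with constant $\mu>0$. Let $\varepsilon>0$ and $x_0\in\mathbb{R}^{m\times n}$, and consider the Muesterov iteration $$y_k=x_k+\beta(x_k-x_{k-1}),\qquad x_{k+1}=y_k-\alpha\,(G_kG_k^\top+\varepsilon^2I)^{-1/2}G_k,\qquad G_k:=\nabla f(y_k),\qquad k\ge0,$$ started with $x_{-1}=x_0$ (so $y_0=x_0$). Then there exist $\bar\beta\in(0,1)$ and a positive function $\bar\alpha:[0,\bar\beta)\to\mathbb{R}_{>0}$ such that for every $\beta\in[0,\bar\beta)$ and every $\alpha\in(0,\bar\alpha(\beta))$ the sequences $\{x_k\}$ and $\{y_k\}$ are bounded and $$\lim_{k\to\infty}\|\nabla f(y_k)\|=0.$$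
   Context: $\|\cdot\|$ denotes the Frobenius norm and $\nabla f$ is the gradient with respect to the Frobenius inner product. $f$ is proper if preimages of compact sets are compact. $f$ is $L$-smooth if it is differentiable and $\|\nabla f(x)-\nabla f(y)\|\le L\|x-y\|$ for all $x,y$. The global Polyak-Łojasiewicz inequality with constant $\mu$ means $\|\nabla f(x)\|^2\ge\mu(f(x)-f^\star)$ for all $x\in\mathbb{R}^{m\times n}$, where $f^\star=\min f=f(x^* )$. $(\cdot)^{-1/2}$ is the inverse of the symmetric positive definite square root. $\bar\beta$ and $\bar\alpha$ may depend on $f$, $\varepsilon$ and $x_0$. *)

(* Defs.v *)
From mathcomp Require Import all_boot all_order all_algebra.
From mathcomp Require Import all_classical all_reals all_analysis.

Set Implicit Arguments.
Unset Strict Implicit.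
Unset Printing Implicit Defensive.

Import Order.TTheory GRing.Theory Num.Theory.
Import numFieldNormedType.Exports.

Local Open Scope classical_set_scope.
Local Open Scope ring_scope.

(* The library norm `|A| on matrices is the max norm, so the Frobenius
   structure is introduced explicitly.  Topological notions (compactness,
   differentiability) are taken from the library: they do not depend on the
   choice of norm in finite dimension. *)
Definition frob_dot (R : realType) (m n : nat) (A B : 'M[R]_(m, n)) : R :=
  \tr (A^T *m B).

Definition frob_norm (R : realType) (m n : nat) (A : 'M[R]_(m, n)) : R :=
  Num.sqrt (frob_dot A A).

(* Riesz representative of the Frechet differential 'd f x for frob_dot, given
   by its entries; see frob_gradE. *)
Definition frob_grad (R : realType) (m n : nat) (f : 'M[R]_(m, n) -> R)
    (x : 'M[R]_(m, n)) : 'M[R]_(m, n) :=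
  \matrix_(i < m, j < n) 'd f x (delta_mx i j).

Lemma frob_dotE (R : realType) (m n : nat) (A B : 'M[R]_(m, n)) :
  frob_dot A B = \sum_i \sum_j A i j * B i j.
Proof.
rewrite /frob_dot /mxtrace exchange_big /=; apply: eq_bigr => j _.
by rewrite mxE; apply: eq_bigr => i _; rewrite mxE.
Qed.

Lemma frob_gradE (R : realType) (m n : nat) (f : 'M[R]_(m, n) -> R)
    (x h : 'M[R]_(m, n)) :
  'd f x h = frob_dot (frob_grad f x) h.
Proof.
rewrite frob_dotE {1}[h]matrix_sum_delta linear_sum /=; apply: eq_bigr => i _.
rewrite linear_sum /=; apply: eq_bigr => j _.
by rewrite linearZ /= mxE mulrC.
Qed.

Definition proper_fun (R : realType) (m n : nat) (f : 'M[R]_(m, n) -> R) :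
    Prop :=
  forall K : set R, compact K -> compact (f @^-1` K).

Definition Lsmooth (R : realType) (m n : nat) (L : R)
    (f : 'M[R]_(m, n) -> R) : Prop :=
  (forall x, differentiable f x) /\
  (forall x y, frob_norm (frob_grad f x - frob_grad f y)
                 <= L * frob_norm (x - y)).

Definition global_minimizer (R : realType) (m n : nat)
    (f : 'M[R]_(m, n) -> R) (x : 'M[R]_(m, n)) : Prop :=
  forall z, f x <= f z.

Definition global_PL (R : realType) (m n : nat) (mu fstar : R)
    (f : 'M[R]_(m, n) -> R) : Prop :=
  forall x, mu * (f x - fstar) <= frob_norm (frob_grad f x) ^+ 2.

Definition sym_posdef (R : realType) (m : nat) (S : 'M[R]_m) : Prop :=
  S^T = S /\ forall v : 'cV[R]_m, v != 0 -> 0 < (v^T *m S *m v) ord0 ord0.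

(* The symmetric positive definite square root; the default 0 is only reached
   when A is not itself symmetric positive definite.  Uniqueness is
   spd_sqrt_uniq. *)
Definition spd_sqrt (R : realType) (m : nat) (A : 'M[R]_m) : 'M[R]_m :=
  xget 0 [set S | sym_posdef S /\ S *m S = A].

Lemma spd_sqrt_uniq (R : realType) (m : nat) (S T : 'M[R]_m) :
  sym_posdef S -> sym_posdef T -> S *m S = T *m T -> S = T.
Proof.
move=> Spos Tpos ST; apply/eqP; rewrite -subr_eq0; set D := S - T.
have Dsym : D^T = D by rewrite /D linearB /= Spos.1 Tpos.1.
have quad (U : 'M[R]_m) : \tr (D *m U *m D) =
    \sum_j ((col j D)^T *m U *m col j D) ord0 ord0.
  apply: eq_bigr => j _; rewrite tr_col Dsym -row_mul !mxE.
  by apply: eq_bigr => k _; rewrite !mxE.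
have ge0 (U : 'M[R]_m) j : sym_posdef U ->
    0 <= ((col j D)^T *m U *m col j D) ord0 ord0.
  move=> [_ Upos]; have [->|/Upos/ltW//] := eqVneq (col j D) 0.
  by rewrite mulmx0 mxE.
have DST : D *m S + T *m D = 0.
  by rewrite /D mulmxBl mulmxBr ST addrA subrK subrr.
have sum0 : \tr (D *m S *m D) + \tr (D *m T *m D) = 0.
  rewrite mxtrace_mulC -mulmxA -raddfD /= -mulmxDr.
  by rewrite DST mulmx0 mxtrace0.
have trT0 : 0 <= \tr (D *m T *m D) by rewrite quad sumr_ge0// => j _; exact: ge0.
have trS0 : \tr (D *m S *m D) = 0.
  apply/eqP; rewrite eq_le {2}quad sumr_ge0 ?andbT; last by move=> j _; exact: ge0.
  by rewrite -sum0 lerDl.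
move: trS0; rewrite quad => /eqP.
rewrite psumr_eq0 => [/allP D0|j _]; last exact: ge0.
apply/eqP/matrixP => i j; rewrite mxE.
have /= /eqP Dj := D0 j (mem_index_enum j).
have [colj|/Spos.2] := eqVneq (col j D) 0; last by rewrite Dj ltxx.
by move/colP: colj => /(_ i); rewrite !mxE.
Qed.

(* The pair (x_(k-1), x_k); the initial value encodes x_(-1) = x_0. *)
Fixpoint muesterov (R : realType) (m n : nat) (f : 'M[R]_(m, n) -> R)
    (eps alpha beta : R) (x0 : 'M[R]_(m, n)) (k : nat) :
    'M[R]_(m, n) * 'M[R]_(m, n) :=
  if k is k'.+1 then
    let: (xprev, x) := muesterov f eps alpha beta x0 k' in
    let y := x + beta *: (x - xprev) in
    let G := frob_grad f y in
    (x, y - alpha *: (invmx (spd_sqrt (G *m G^T + (eps ^+ 2)%:M)) *m G))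
  else (x0, x0).

Definition muesterov_x (R : realType) (m n : nat) (f : 'M[R]_(m, n) -> R)
    (eps alpha beta : R) (x0 : 'M[R]_(m, n)) (k : nat) : 'M[R]_(m, n) :=
  (muesterov f eps alpha beta x0 k).2.

Definition muesterov_y (R : realType) (m n : nat) (f : 'M[R]_(m, n) -> R)
    (eps alpha beta : R) (x0 : 'M[R]_(m, n)) (k : nat) : 'M[R]_(m, n) :=
  let: (xprev, x) := muesterov f eps alpha beta x0 k in
  x + beta *: (x - xprev).

Lemma muesterov_xE0 (R : realType) (m n : nat) (f : 'M[R]_(m, n) -> R)
    (eps alpha beta : R) (x0 : 'M[R]_(m, n)) :
  muesterov_x f eps alpha beta x0 0 = x0.
Proof. by []. Qed.

Lemma muesterov_yE0 (R : realType) (m n : nat) (f : 'M[R]_(m, n) -> R)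
    (eps alpha beta : R) (x0 : 'M[R]_(m, n)) :
  muesterov_y f eps alpha beta x0 0 = x0.
Proof. by rewrite /muesterov_y /= subrr scaler0 addr0. Qed.

Lemma muesterov_xES (R : realType) (m n : nat) (f : 'M[R]_(m, n) -> R)
    (eps alpha beta : R) (x0 : 'M[R]_(m, n)) (k : nat) :
  let y := muesterov_y f eps alpha beta x0 k in
  let G := frob_grad f y in
  muesterov_x f eps alpha beta x0 k.+1
  = y - alpha *: (invmx (spd_sqrt (G *m G^T + (eps ^+ 2)%:M)) *m G).
Proof. by rewrite /muesterov_x /muesterov_y /=; case: muesterov. Qed.

Lemma muesterov_yES (R : realType) (m n : nat) (f : 'M[R]_(m, n) -> R)
    (eps alpha beta : R) (x0 : 'M[R]_(m, n)) (k : nat) :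
  let x := muesterov_x f eps alpha beta x0 in
  muesterov_y f eps alpha beta x0 k.+1 = x k.+1 + beta *: (x k.+1 - x k).
Proof. by rewrite /muesterov_x /muesterov_y /=; case: muesterov. Qed.

Definition frob_bounded (R : realType) (m n : nat)
    (u : nat -> 'M[R]_(m, n)) : Prop :=
  exists M : R, forall k, frob_norm (u k) <= M.

(* Main.v *)
Require Import Defs.
From mathcomp Require Import all_boot all_order all_algebra.
From mathcomp Require Import complex.
From mathcomp Require Import all_classical all_reals all_analysis.
From mathcomp Require Import ring lra.

(** The iteration is a descent method for an energy in which the momentum enters
as kinetic energy.  Write [d_k = x_k - x_(k-1)], [G = G_k], [S] for the square
root of [G G^T + eps^2 I] and [P = S^-1 G], and let
[E_k = f x_k + (C / alpha) |d_k|^2] with [C = eps / 8].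

The preconditioner enters only through two inequalities:
[eps |P|^2 <= <G, P>] ([precond_norm_le]) and [|G|^2 <= s <G, P>], valid as soon
as [|G|^2 + eps^2 <= s^2] ([precond_dot_lower]).  Both follow from the
Cauchy-Schwarz inequality for the form [<X, S Y>], so that nothing about [S] is
needed beyond [S] being positive definite with the right square; that such an
[S] exists is [spd_sqrt_exists].

With these, expanding [f] to first order at [y_k] towards [x_k] and towards
[x_(k+1)] gives [E_(k+1) + (alpha / 4) <G, P> <= E_k] for all small [beta] and
[alpha] ([energy_step]).  How small depends on [s], hence on a bound for the
gradient at [y_k].  Such a bound propagates by induction: [E_k <= E_0 = f x_0]
forces [x_k] into the sublevel set of [f] at [f x_0], which is bounded because
[f] is proper, and [|d_k|^2 <= (f x_0 - min f) / C] for [alpha <= 1], so that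
[y_k] stays in a ball independent of [k], [alpha] and [beta], on which the
Lipschitz gradient is bounded.

Boundedness of both sequences is part of this induction.  As [E_k] is bounded
below, its decrements tend to zero ([cvg0_of_energy]), hence so do [<G, P>] and
[|G_k|]. *)

Set Implicit Arguments.
Unset Strict Implicit.
Unset Printing Implicit Defensive.

Import Order.TTheory GRing.Theory Num.Theory.
Import numFieldNormedType.Exports.

Local Open Scope classical_set_scope.
Local Open Scope ring_scope.

(** * The Frobenius inner product *)

Section Frobenius.
Context {R : realType}.
Implicit Types m n p : nat.

Lemma frob_dotC m n (A B : 'M[R]_(m, n)) : frob_dot A B = frob_dot B A.
Proof.
rewrite !frob_dotE; apply: eq_bigr => i _; apply: eq_bigr => j _.
exact: mulrC.
Qed.

Lemma frob_dotDl m n (A B C : 'M[R]_(m, n)) :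
  frob_dot (A + B) C = frob_dot A C + frob_dot B C.
Proof. by rewrite /frob_dot linearD /= mulmxDl linearD. Qed.

Lemma frob_dotZl m n (a : R) (A B : 'M[R]_(m, n)) :
  frob_dot (a *: A) B = a * frob_dot A B.
Proof. by rewrite /frob_dot linearZ /= -scalemxAl linearZ. Qed.

Lemma frob_dotNl m n (A B : 'M[R]_(m, n)) : frob_dot (- A) B = - frob_dot A B.
Proof. by rewrite -scaleN1r frob_dotZl mulN1r. Qed.

Lemma frob_dotDr m n (A B C : 'M[R]_(m, n)) :
  frob_dot A (B + C) = frob_dot A B + frob_dot A C.
Proof. by rewrite frob_dotC frob_dotDl !(frob_dotC _ A). Qed.

Lemma frob_dotZr m n (a : R) (A B : 'M[R]_(m, n)) :
  frob_dot A (a *: B) = a * frob_dot A B.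
Proof. by rewrite frob_dotC frob_dotZl frob_dotC. Qed.

Lemma frob_dotNr m n (A B : 'M[R]_(m, n)) : frob_dot A (- B) = - frob_dot A B.
Proof. by rewrite frob_dotC frob_dotNl frob_dotC. Qed.

Lemma frob_dot_ge0 m n (A : 'M[R]_(m, n)) : 0 <= frob_dot A A.
Proof.
rewrite frob_dotE; apply: sumr_ge0 => i _; apply: sumr_ge0 => j _.
by rewrite -expr2 sqr_ge0.
Qed.

Lemma frob_norm_ge0 m n (A : 'M[R]_(m, n)) : 0 <= frob_norm A.
Proof. exact: sqrtr_ge0. Qed.

Lemma frob_norm_sqr m n (A : 'M[R]_(m, n)) : frob_norm A ^+ 2 = frob_dot A A.
Proof. by rewrite sqr_sqrtr// frob_dot_ge0. Qed.

Lemma frob_normZ m n (a : R) (A : 'M[R]_(m, n)) :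
  frob_norm (a *: A) = `|a| * frob_norm A.
Proof.
by rewrite /frob_norm frob_dotZl frob_dotZr mulrA -expr2 sqrtrM ?sqr_ge0// sqrtr_sqr.
Qed.

Lemma frob_normN m n (A : 'M[R]_(m, n)) : frob_norm (- A) = frob_norm A.
Proof. by rewrite -scaleN1r frob_normZ normrN1 mul1r. Qed.

Lemma frob_dot_mulmx m n p (S : 'M[R]_(p, m)) (X : 'M[R]_(m, n)) (Y : 'M[R]_(p, n)) :
  frob_dot Y (S *m X) = frob_dot (S^T *m Y) X.
Proof. by rewrite /frob_dot trmx_mul trmxK mulmxA. Qed.

(** The quadratic polynomial [t |-> <t X + Y, S (t X + Y)>] is nonnegative, so
its discriminant is nonpositive.  Being able to choose [S] is what replaces
spectral bounds on matrix square roots below. *)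
Lemma psd_CauchySchwarz m n (S : 'M[R]_m) (X Y : 'M[R]_(m, n)) :
  S^T = S -> (forall Z : 'M[R]_(m, n), 0 <= frob_dot Z (S *m Z)) ->
  frob_dot X (S *m Y) ^+ 2 <= frob_dot X (S *m X) * frob_dot Y (S *m Y).
Proof.
move=> Ssym Spsd.
have sym : frob_dot Y (S *m X) = frob_dot X (S *m Y).
  by rewrite frob_dot_mulmx Ssym frob_dotC.
have q t : 0 <= frob_dot X (S *m X) * t ^+ 2 + (2 * frob_dot X (S *m Y)) * t
               + frob_dot Y (S *m Y).
  have := Spsd (t *: X + Y).
  rewrite mulmxDr -scalemxAr !(frob_dotDl, frob_dotDr, frob_dotZl, frob_dotZr) sym.
  by congr (0 <= _); ring.
pose a := frob_dot X (S *m X); pose b := 2 * frob_dot X (S *m Y).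
pose c := frob_dot Y (S *m Y).
have := @deg_le2_poly_ge0 _ (Poly [:: c; b; a]).
rewrite size_Poly !coef_Poly /= => /(_ isT).
have h t : 0 <= (Poly [:: c; b; a]).[t].
  by rewrite horner_Poly /=; have := q t; rewrite -/a -/b -/c; congr (0 <= _); ring.
by move=> /(_ h); rewrite -/a -/c /b; lra.
Qed.

Lemma frob_CauchySchwarz_sqr m n (X Y : 'M[R]_(m, n)) :
  frob_dot X Y ^+ 2 <= frob_dot X X * frob_dot Y Y.
Proof.
have := @psd_CauchySchwarz m n 1%:M X Y (trmx1 _ _).
rewrite !mul1mx; apply => Z; rewrite mul1mx; exact: frob_dot_ge0.
Qed.

Lemma frob_CauchySchwarz m n (X Y : 'M[R]_(m, n)) :
  `|frob_dot X Y| <= frob_norm X * frob_norm Y.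
Proof.
rewrite -(ler_pXn2r (n := 2))// ?nnegrE ?normr_ge0 ?mulr_ge0 ?frob_norm_ge0//.
rewrite real_normK ?num_real// exprMn !frob_norm_sqr.
exact: frob_CauchySchwarz_sqr.
Qed.

Lemma frob_norm_triangle m n (X Y : 'M[R]_(m, n)) :
  frob_norm (X + Y) <= frob_norm X + frob_norm Y.
Proof.
rewrite -(ler_pXn2r (n := 2))// ?nnegrE ?addr_ge0 ?frob_norm_ge0//.
rewrite frob_norm_sqr !(frob_dotDl, frob_dotDr) (frob_dotC Y X).
rewrite sqrrD !frob_norm_sqr.
have := ler_norm (frob_dot X Y); have := frob_CauchySchwarz X Y; lra.
Qed.

Lemma frob_dot_mulmx_le m n p (X : 'M[R]_(m, n)) (Y : 'M[R]_(n, p)) :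
  frob_dot (X *m Y) (X *m Y) <= frob_dot X X * frob_dot Y Y.
Proof.
rewrite !frob_dotE mulr_suml; apply: ler_sum => i _.
rewrite exchange_big mulr_sumr /=; apply: ler_sum => j _.
have rowE u v : frob_dot (row u X) (col v Y)^T = (X *m Y) u v.
  by rewrite frob_dotE big_ord1 mxE; apply: eq_bigr => k _; rewrite !mxE.
have sqE q (u : 'rV[R]_q) : frob_dot u u = \sum_k u 0 k * u 0 k.
  by rewrite frob_dotE big_ord1.
rewrite -expr2 -rowE (le_trans (frob_CauchySchwarz_sqr _ _))// !sqE.
have -> : \sum_k row i X 0 k * row i X 0 k = \sum_k X i k * X i k.
  by apply: eq_bigr => k _; rewrite !mxE.
have -> // : \sum_k (col j Y)^T 0 k * (col j Y)^T 0 k = \sum_k Y k j * Y k j.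
by apply: eq_bigr => k _; rewrite !mxE.
Qed.

(** Links the Frobenius norm with the max norm that defines the topology of
matrices. *)
Lemma frob_norm_le_mxnorm m n (X : 'M[R]_(m, n)) :
  frob_norm X <= Num.sqrt (m * n)%:R * `|X|.
Proof.
rewrite -(ler_pXn2r (n := 2))// ?nnegrE ?mulr_ge0 ?frob_norm_ge0 ?sqrtr_ge0//.
rewrite frob_norm_sqr frob_dotE exprMn sqr_sqrtr ?ler0n//.
have -> : (m * n)%:R * `|X| ^+ 2 = \sum_(i < m) \sum_(j < n) `|X| ^+ 2.
  by rewrite !sumr_const !card_ord -mulrnA mulr_natl mulnC.
apply: ler_sum => i _; apply: ler_sum => j _.
rewrite -expr2 -real_normK ?num_real// ler_pXn2r ?nnegrE//.
rewrite /Num.norm /= mx_normrE.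
exact: (le_bigmax _ (fun ij : 'I_m * 'I_n => `|X ij.1 ij.2|) (i, j)).
Qed.

(** * First-order expansion of a smooth function *)

(** The mean value theorem for the restriction of [f] to the line [x + t h]. *)
Lemma frob_mean_value m n (f : 'M[R]_(m, n) -> R) (x h : 'M[R]_(m, n)) :
  (forall z, differentiable f z) ->
  exists2 t, 0 <= t <= 1 & f (x + h) - f x = frob_dot (frob_grad f (x + t *: h)) h.
Proof.
move=> df.
have der t : is_derive (t : R) 1 (fun s : R => f (x + s *: h))
                (frob_dot (frob_grad f (x + t *: h)) h).
  have -> : frob_dot (frob_grad f (x + t *: h)) h = 'D_h f (x + t *: h).
    by rewrite -frob_gradE deriveE.
  (* The difference quotients of the restriction and of [f] in direction [h]
     are the same function of the increment. *)
  have E : (fun e : R => e^-1 *: ((f \o shift (x + t *: h)) (e *: h) - f (x + t *: h)))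
    = (fun e : R => e^-1 *: (((fun s : R => f (x + s *: h)) \o shift t) (e *: 1)
                               - f (x + t *: h))).
    apply/funext => e /=; congr (_ *: (f _ - _)).
    by rewrite -[e *: 1]/(e * 1) mulr1 scalerDl addrCA addrC.
  have [+ _] := pair (@diff_derivable _ _ _ f (x + t *: h) h (df _)) I.
  rewrite /derivable E => dv; split; first exact: dv.
  by rewrite /derive E.
have [] := @MVT_segment R (fun s : R => f (x + s *: h))
  (fun t => frob_dot (frob_grad f (x + t *: h)) h) 0 1 ler01 (fun t _ => der t).
  apply: continuous_subspaceT => t.
  exact/differentiable_continuous/derivable1_diffP/(@ex_derive _ _ _ _ _ _ _ (der t)).
move=> c; rewrite in_itv /= => c01; rewrite scale1r scale0r addr0 subr0 mulr1 => E.
by exists c.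
Qed.

(** Two-sided first-order bound, needed in both directions: at [y] towards the
new iterate it bounds [f] from above, towards the old iterate from below.
The mean value theorem gives the constant [L] instead of the sharp [L / 2],
which only changes the admissible step sizes. *)
Lemma Lsmooth_taylor m n (L : R) (f : 'M[R]_(m, n) -> R) (x h : 'M[R]_(m, n)) :
  0 <= L -> Lsmooth L f ->
  `|f (x + h) - f x - frob_dot (frob_grad f x) h| <= L * frob_norm h ^+ 2.
Proof.
move=> L0 [df lip]; have [t /andP[t0 t1] ->] := frob_mean_value x h df.
rewrite -frob_dotNl -frob_dotDl (le_trans (frob_CauchySchwarz _ _))//.
rewrite expr2 mulrA ler_wpM2r ?frob_norm_ge0// (le_trans (lip _ _))//.
rewrite addrAC subrr add0r frob_normZ ger0_norm// ler_wpM2l//.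
by rewrite ler_piMl ?frob_norm_ge0.
Qed.
End Frobenius.

(** * Square roots of positive definite matrices *)

Lemma poly_interpolation (F : fieldType) (g : F -> F) (s : seq F) :
  exists q : {poly F}, {in s, forall x, q.[x] = g x}.
Proof.
elim: s => [|x s [q qE]]; first by exists 0.
have [xs|xs] := boolP (x \in s).
  by exists q => y; rewrite inE => /predU1P[->|/qE//]; exact: qE.
pose w := \prod_(z <- s) ('X - z%:P).
have wx : w.[x] != 0 by rewrite -[_ == 0]/(root w x) root_prod_XsubC.
exists (q + ((g x - q.[x]) / w.[x]) *: w) => y; rewrite inE => /predU1P[->|ys].
  by rewrite hornerD hornerZ divfK// subrKC.
have /eqP wy : root w y by rewrite root_prod_XsubC.
by rewrite hornerD hornerZ wy mulr0 addr0 qE.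
Qed.

Lemma trmx_horner_mx (F : fieldType) (m : nat) (A : 'M[F]_m.+1) (q : {poly F}) :
  (horner_mx A q)^T = horner_mx A^T q.
Proof.
elim/poly_ind: q => [|q c IH]; first by rewrite !raddf0.
rewrite !rmorphD !rmorphM /= !horner_mx_X !horner_mx_C linearD /= tr_scalar_mx.
rewrite trmx_mul IH; congr (_ + _).
exact: (@comm_mx_horner _ _ A^T A^T).
Qed.

(** Over [R[i]] the matrix is unitarily diagonalizable with real diagonal [D],
and [q (P^-1 D P) = P^-1 q(D) P]; the eigenvalues and the polynomial identity
then descend to [R].  This form of the spectral theorem is enough for
functional calculus and spares the construction of a real eigenbasis. *)
Lemma symmetric_annihilator (R : realType) (m : nat) (A : 'M[R]_m.+1) :
  A^T = A -> exists d : seq R,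
    {in d, forall r, eigenvalue A r} /\
    forall q : {poly R}, {in d, forall r, root q r} -> horner_mx A q = 0.
Proof.
move=> Asym; pose C := (R[i])%C; pose toC := real_complex R.
pose Ac : 'M[C]_m.+1 := map_mx toC A.
have Areal : Ac \is a mxOver Num.real.
  by apply/mxOverP => i j; rewrite mxE; apply/complex_realP; exists (A i j).
have Aherm : Ac \is hermsymmx.
  apply: realsym_hermsym => //.
  rewrite qualifE /=; apply/eqP.
  by rewrite expr0 scale1r map_mx_id// /Ac map_trmx Asym.
have /orthomx_spectralP := hermitian_normalmx Aherm.
set P := spectralmx Ac; set D := spectral_diag Ac => AE.
have Pu : P \in unitmx := spectral_unit Ac.
have Dreal j : D 0 j = toC (complex.Re (D 0 j)).
  have /mxOverP/(_ 0 j) := hermitian_spectral_diag_real Aherm.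
  by move=> /RRe_real/esym.
exists [seq complex.Re (D 0 j) | j : 'I_m.+1]; split.
  move=> _ /mapP[j _ ->]; suff: eigenvalue Ac (D 0 j) by rewrite Dreal /Ac eigenvalue_map.
  apply/eigenvalueP; exists (row j P).
    rewrite -/Ac {1}AE -row_mul !mulmxA mulmxV// mul1mx.
    by rewrite row_mul row_diag_mx -scalemxAl -rowE.
  apply/eqP => P0; have := row_free_unit P; rewrite Pu => /row_freeP[Q PQ].
  have := congr1 (row j) PQ; rewrite row_mul P0 mul0mx row1 => /matrixP/(_ 0 j)/eqP.
  by rewrite !mxE !eqxx /= eq_sym oner_eq0.
move=> q qroot; apply: (@map_mx_inj _ _ toC).
rewrite map_horner_mx -/Ac AE map_mx0.
have -> := @horner_mx_uconjC _ _ (map_poly toC q) P (diag_mx D) Pu.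
rewrite horner_mx_diag.
suff -> : map_mx (horner (map_poly toC q)) D = 0.
  by rewrite linear0 mulmx0 mul0mx.
apply/matrixP => i j; rewrite !mxE ord1 Dreal horner_map.
suff /eqP -> : root q (complex.Re (D 0 j)) by rewrite rmorph0.
by apply/qroot/map_f; rewrite mem_enum.
Qed.

Lemma spd_eigenvalue_gt0 (R : realType) (m : nat) (A : 'M[R]_m) (r : R) :
  sym_posdef A -> eigenvalue A r -> 0 < r.
Proof.
move=> [Asym Apos] /eigenvalueP[v vA v0].
have vT0 : v^T != 0 by rewrite trmx_eq0.
have := Apos _ vT0; rewrite trmxK vA -scalemxAl mxE.
have : 0 <= (v *m v^T) 0 0.
  by rewrite mxE; apply: sumr_ge0 => i _; rewrite mxE -expr2 sqr_ge0.
move=> + /[dup] rv; rewrite le_eqVlt => /predU1P[v0'|vv]; last by rewrite pmulr_lgt0.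
by move: rv; rewrite -v0' mulr0 ltxx.
Qed.

(** Let [q] interpolate the fourth root on the spectrum of [A] and [T := q(A)],
so that [T ^ 4 = A].  Then [S := T ^ 2] is a square root of [A], and it is
positive definite for free, because [v^T S v = |T v|^2] and [T] is
injective. *)
Lemma spd_sqrt_exists (R : realType) (m : nat) (A : 'M[R]_m) :
  sym_posdef A -> exists S, sym_posdef S /\ S *m S = A.
Proof.
case: m A => [|m] A Aspd.
  exists 0; split; last by apply/matrixP; case.
  by split=> [|v /eqP[]]; [apply/matrixP; case | apply/matrixP; case].
have Asym := Aspd.1; have [d [deig dann]] := symmetric_annihilator Asym.
have [q qE] := poly_interpolation (fun r : R => Num.sqrt (Num.sqrt r)) d.
pose T := horner_mx A q.
have T4 : (T * T) * (T * T) = A.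
  apply/eqP; rewrite -subr_eq0 -[X in _ - X](horner_mx_X A) /T -!rmorphM -rmorphB /=.
  apply/eqP/dann => r rd; apply/rootP; rewrite hornerD hornerN !hornerM hornerX qE//.
  have r0 := ltW (spd_eigenvalue_gt0 Aspd (deig _ rd)).
  by rewrite -!expr2 sqr_sqrtr ?sqrtr_ge0// sqr_sqrtr// subrr.
have Tsym : T^T = T by rewrite trmx_horner_mx Asym.
have Tinj (v : 'cV_m.+1) : v != 0 -> T *m v != 0.
  move=> v0; apply/eqP => Tv.
  have := Aspd.2 _ v0; rewrite -T4 -!mulmxE -!mulmxA Tv !mulmx0.
  by rewrite mxE ltxx.
exists (T *m T); split; last exact: T4.
split=> [|v v0]; first by rewrite trmx_mul Tsym.
have -> : v^T *m (T *m T) *m v = (T *m v)^T *m (T *m v).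
  by rewrite trmx_mul Tsym !mulmxA.
rewrite lt_def; apply/andP; split; last first.
  by rewrite mxE; apply: sumr_ge0 => i _; rewrite mxE -expr2 sqr_ge0.
apply: contra (Tinj v v0); rewrite mxE psumr_eq0 => [/allP sq0|i _]; last first.
  by rewrite mxE -expr2 sqr_ge0.
apply/eqP/colP => i; have /= := sq0 i (mem_index_enum i).
by rewrite [(_^T) _ _]mxE -expr2 sqrf_eq0 [in RHS]mxE => /eqP.
Qed.

Lemma spd_sqrtP (R : realType) (m : nat) (A : 'M[R]_m) :
  sym_posdef A -> sym_posdef (spd_sqrt A) /\ spd_sqrt A *m spd_sqrt A = A.
Proof.
move=> /spd_sqrt_exists[S SA].
exact: (@xgetPex _ 0 [set S | sym_posdef S /\ S *m S = A] (ex_intro _ S SA)).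
Qed.

Lemma spd_unitmx (R : realType) (m : nat) (S : 'M[R]_m) :
  sym_posdef S -> S \in unitmx.
Proof.
move=> [_ Spos]; rewrite -row_free_unit -kermx_eq0; apply/rowV0P => v.
move=> /sub_kermxP vS; apply/eqP; rewrite -trmx_eq0; apply/negPn/negP => /Spos.
by rewrite trmxK vS mul0mx mxE ltxx.
Qed.

Lemma spd_frob_dot_ge0 (R : realType) (m n : nat) (S : 'M[R]_m) (Z : 'M[R]_(m, n)) :
  sym_posdef S -> 0 <= frob_dot Z (S *m Z).
Proof.
move=> [_ Spos].
have -> : frob_dot Z (S *m Z) = \sum_j ((col j Z)^T *m S *m col j Z) 0 0.
  rewrite /frob_dot; apply: eq_bigr => j _.
  by rewrite mulmxA tr_col -row_mul !mxE; apply: eq_bigr => k _; rewrite !mxE.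
apply: sumr_ge0 => j _; have [->|/Spos/ltW//] := eqVneq (col j Z) 0.
by rewrite mulmx0 mxE.
Qed.

(** * The preconditioned gradient *)

Section Preconditioner.
Context {R : realType} {m n : nat}.
Variables (eps : R) (G : 'M[R]_(m, n)).
Hypothesis eps_gt0 : 0 < eps.
Let A := G *m G^T + (eps ^+ 2)%:M.
Let S := spd_sqrt A.
Let P := invmx S *m G.

Lemma frob_dot_gram p (Z : 'M[R]_(m, p)) : frob_dot Z (A *m Z) =
   frob_dot (G^T *m Z) (G^T *m Z) + eps ^+ 2 * frob_dot Z Z.
Proof.
rewrite mulmxDl frob_dotDr mul_scalar_mx frob_dotZr -mulmxA.
by rewrite frob_dot_mulmx.
Qed.

Lemma gram_spd : sym_posdef A.
Proof.
split=> [|v v0]; first by rewrite linearD /= trmx_mul trmxK tr_scalar_mx.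
have -> : (v^T *m A *m v) ord0 ord0 = frob_dot v (A *m v).
  by rewrite /frob_dot /mxtrace big_ord1 mulmxA.
rewrite frob_dot_gram ltr_wpDl ?frob_dot_ge0// mulr_gt0 ?exprn_gt0//.
rewrite lt_def frob_dot_ge0 andbT; apply: contra v0; rewrite frob_dotE.
rewrite psumr_eq0 => [/allP v0|i _]; last by rewrite big_ord1 -expr2 sqr_ge0.
apply/eqP/colP => i; have := v0 i (mem_index_enum i).
by rewrite big_ord1 -expr2 sqrf_eq0 mxE => /eqP.
Qed.

Let Sspd : sym_posdef S. Proof. exact: (spd_sqrtP gram_spd).1. Qed.
Let SS : S *m S = A. Proof. exact: (spd_sqrtP gram_spd).2. Qed.
Let Sunit : S \in unitmx. Proof. exact: spd_unitmx Sspd. Qed.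
Let SP : S *m P = G. Proof. by rewrite mulKVmx. Qed.

Lemma frob_norm_sqrt_gram p (Z : 'M[R]_(m, p)) :
  frob_dot (S *m Z) (S *m Z) =
  frob_dot (G^T *m Z) (G^T *m Z) + eps ^+ 2 * frob_dot Z Z.
Proof. by rewrite -frob_dot_gram -SS -mulmxA [RHS]frob_dot_mulmx Sspd.1. Qed.

Let quadP : frob_dot P (S *m P) = frob_dot G P.
Proof. by rewrite SP frob_dotC. Qed.

Lemma precond_dot_ge0 : 0 <= frob_dot G P.
Proof. by rewrite -quadP spd_frob_dot_ge0. Qed.

(** Here [<G, P> = <P, S P>].  With [S W = P], Cauchy-Schwarz for the form of
[S] gives [|P|^4 = <P, S W>^2 <= <P, S P> <W, P>], and
[eps |W| <= |P|] because [S ^ 2] dominates [eps ^ 2]. *)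
Lemma precond_norm_le : eps * frob_dot P P <= frob_dot G P.
Proof.
pose W := invmx S *m P.
have SW : S *m W = P by rewrite mulKVmx.
have WP : eps * frob_norm W <= frob_norm P.
  rewrite -(ler_pXn2r (n := 2))// ?nnegrE ?mulr_ge0 ?frob_norm_ge0 ?(ltW eps_gt0)//.
  rewrite exprMn !frob_norm_sqr -[X in _ <= frob_dot X X]SW frob_norm_sqrt_gram lerDr.
  exact: frob_dot_ge0.
have := psd_CauchySchwarz P W Sspd.1 (fun Z => spd_frob_dot_ge0 Z Sspd).
rewrite quadP SW => CS.
have WPle : eps * frob_dot W P <= frob_dot P P.
  rewrite -frob_norm_sqr expr2 -[X in _ <= X](mulrC).
  apply: le_trans (ler_wpM2r (frob_norm_ge0 P) WP).
  rewrite -mulrA ler_pM2l// (le_trans (ler_norm _))//; exact: frob_CauchySchwarz.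
have [P0|P0] := eqVneq (frob_dot P P) 0; first by rewrite P0 mulr0 precond_dot_ge0.
have Pgt0 : 0 < frob_dot P P by rewrite lt_def P0 frob_dot_ge0.
rewrite -(ler_pM2r Pgt0) -mulrA -expr2.
apply: le_trans (ler_wpM2l precond_dot_ge0 WPle).
by rewrite [X in _ <= X]mulrCA ler_pM2l.
Qed.

(** Cauchy-Schwarz for the form of [S] gives [|G|^4 = <P, S G>^2 <=
<P, S P> <G, S G>], and [|S G| <= s |G|] because [S ^ 2 = G G^T + eps ^ 2] and
[|G^T G| <= |G|^2]. *)
Lemma precond_dot_lower (s : R) : 0 <= s -> frob_dot G G + eps ^+ 2 <= s ^+ 2 ->
  frob_dot G G <= s * frob_dot G P.
Proof.
move=> s0 Gs.
have SGle : frob_norm (S *m G) <= s * frob_norm G.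
  rewrite -(ler_pXn2r (n := 2))// ?nnegrE ?mulr_ge0 ?frob_norm_ge0//.
  rewrite exprMn !frob_norm_sqr frob_norm_sqrt_gram.
  apply: le_trans (ler_wpM2r (frob_dot_ge0 G) Gs).
  rewrite mulrDl lerD2r (le_trans (frob_dot_mulmx_le _ _))//.
  by rewrite ler_wpM2r ?frob_dot_ge0// /frob_dot trmxK mxtrace_mulC.
have := psd_CauchySchwarz P G Sspd.1 (fun Z => spd_frob_dot_ge0 Z Sspd).
rewrite quadP frob_dot_mulmx Sspd.1 SP => CS.
have GSG : frob_dot G (S *m G) <= s * frob_dot G G.
  apply: le_trans (ler_norm _) _; apply: le_trans (frob_CauchySchwarz _ _) _.
  by rewrite -frob_norm_sqr expr2 mulrCA ler_wpM2l ?frob_norm_ge0.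
have [G0|G0] := eqVneq (frob_dot G G) 0.
  by rewrite G0 mulr_ge0 ?precond_dot_ge0.
have Ggt0 : 0 < frob_dot G G by rewrite lt_def G0 frob_dot_ge0.
rewrite -(ler_pM2r Ggt0) -expr2.
by rewrite (le_trans CS)// (mulrC s) -mulrA ler_wpM2l ?precond_dot_ge0.
Qed.
End Preconditioner.

(** * Energy decrease *)

(** Without preconditioning the cross term [beta <G, d>] would cancel against the one in the kinetic energy; here it is
absorbed by Young's inequality, at the price of [s * beta ^ 2 / alpha * |d|^2].
The weight [1 / alpha] of the kinetic energy makes this price a fixed fraction
of it when [beta ^ 2 * s] is small, uniformly in [alpha]; with [C = eps / 8]
the kinetic energy created by the step itself costs at most a quarter of
[alpha <G, P>]. *)
Lemma energy_step (R : realType) (m n : nat) (f : 'M[R]_(m, n) -> R)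
    (L eps s alpha beta : R) (x d P : 'M[R]_(m, n)) :
  let y := x + beta *: d in
  let G := frob_grad f y in
  let x' := y - alpha *: P in
  let C := eps / 8 in
  0 < L -> Lsmooth L f -> 0 < s -> 0 < alpha -> alpha <= eps / (4 * L) ->
  beta ^+ 2 * (4 * C + s) <= C ->
  eps * frob_dot P P <= frob_dot G P -> frob_dot G G <= s * frob_dot G P ->
  f x' + C / alpha * frob_norm (x' - x) ^+ 2 + alpha / 4 * frob_dot G P <=
  f x + C / alpha * frob_norm d ^+ 2.
Proof.
move=> y G x' C L0 fL s0 a0 aL bC Pq Gq.
have fx' : f x' <= f y - alpha * frob_dot G P + L * alpha ^+ 2 * frob_dot P P.
  have := Lsmooth_taylor y (- (alpha *: P)) (ltW L0) fL.
  rewrite frob_dotNr frob_dotZr frob_normN frob_normZ exprMn real_normK ?num_real//.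
  by rewrite frob_norm_sqr -/G -/x' ler_norml => /andP[_]; lra.
have fy : f y <= f x + beta * frob_dot G d + L * beta ^+ 2 * frob_dot d d.
  have := Lsmooth_taylor y (- (beta *: d)) (ltW L0) fL.
  rewrite frob_dotNr frob_dotZr frob_normN frob_normZ exprMn real_normK ?num_real//.
  by rewrite frob_norm_sqr -/G /y addrK -/y ler_norml => /andP[+ _]; lra.
have x'x : frob_norm (x' - x) ^+ 2 <=
    2 * beta ^+ 2 * frob_dot d d + 2 * alpha ^+ 2 * frob_dot P P.
  have -> : x' - x = beta *: d - alpha *: P.
    by rewrite /x' /y [x + _]addrC -!addrA; congr (_ + _); rewrite addrC addrNK.
  (* parallelogram law: |u - v|^2 <= 2 |u|^2 + 2 |v|^2 *)
  have := frob_dot_ge0 (beta *: d + alpha *: P).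
  rewrite frob_norm_sqr.
  rewrite !(frob_dotDl, frob_dotDr, frob_dotNl, frob_dotNr, frob_dotZl, frob_dotZr).
  by rewrite (frob_dotC d P); lra.
have Gd : alpha * (beta * frob_dot G d) <=
    alpha ^+ 2 / 4 * frob_dot G P + s * beta ^+ 2 * frob_dot d d.
  (* Young's inequality, with the weight that balances the two squares. *)
  have := frob_dot_ge0 (alpha *: G - (2 * s * beta) *: d).
  rewrite !(frob_dotDl, frob_dotDr, frob_dotNl, frob_dotNr, frob_dotZl, frob_dotZr).
  rewrite (frob_dotC d G) => sq.
  have a2G := ler_wpM2l (sqr_ge0 alpha) Gq.
  by rewrite -(ler_pM2l s0); lra.
have aL4 : 4 * (alpha * L) <= eps.
  by move: aL; rewrite ler_pdivlMr ?mulr_gt0//; lra.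
set q := frob_dot G P in Pq Gq fx' Gd *.
have P0 := frob_dot_ge0 P; have d0 := frob_dot_ge0 d.
move: Pq fx' fy x'x Gd P0 d0; rewrite !frob_norm_sqr.
move: (frob_dot P P) (frob_dot d d) (frob_dot (x' - x) (x' - x)) (frob_dot G d).
move=> p2 d2 e b Pq fx' fy x'x Gd P0 d0.
have C0 : 0 < C.
  have : 0 < alpha * L by rewrite mulr_gt0.
  by rewrite /C; lra.
rewrite -(ler_pM2l a0).
have -> : alpha * (f x' + C / alpha * e + alpha / 4 * q) =
   alpha * f x' + C * e + alpha ^+ 2 / 4 * q.
  by field; rewrite gt_eqF.
have -> : alpha * (f x + C / alpha * d2) = alpha * f x + C * d2.
  by field; rewrite gt_eqF.
have h1 := ler_wpM2l (ltW a0) fx'.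
have h2 := ler_wpM2l (ltW a0) fy.
have h3 := ler_wpM2l (ltW C0) x'x.
have h4 := ler_wpM2r d0 bC.
have h5 := ler_wpM2l (sqr_ge0 alpha) Pq.
have h6 : alpha ^+ 2 * p2 * (4 * (alpha * L)) <= alpha ^+ 2 * p2 * eps.
  exact: ler_wpM2l (mulr_ge0 (sqr_ge0 _) P0) _ _ aL4.
have h7 : beta ^+ 2 * d2 * (4 * (alpha * L)) <= beta ^+ 2 * d2 * eps.
  exact: ler_wpM2l (mulr_ge0 (sqr_ge0 _) d0) _ _ aL4.
have Ce : C = eps / 8 by [].
rewrite Ce in h3 h4 *; lra.
Qed.

(** * Convergence of the iteration *)

Lemma compact_frob_bounded (R : realType) (m n : nat) (K : set 'M[R]_(m, n)) :
  compact K -> exists D, forall x, K x -> frob_norm x <= D.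
Proof.
move=> /compact_bounded[N [_ NK]]; exists (Num.sqrt (m * n)%:R * (N + 1)) => x Kx.
apply: le_trans (frob_norm_le_mxnorm x) _; rewrite ler_wpM2l ?sqrtr_ge0//.
by apply: NK => //; rewrite ltrDl.
Qed.

(** The nonincreasing energy converges, so its decrements, which dominate [c * g],
tend to zero. *)
Lemma cvg0_of_energy (R : realType) (E g : nat -> R) (c l : R) :
  0 < c -> (forall k, 0 <= g k) -> (forall k, l <= E k) ->
  (forall k, E k.+1 + c * g k <= E k) -> g @ \oo --> (0 : R).
Proof.
move=> c0 g0 El Eg.
have Edec : nonincreasing_seq E.
  apply/nonincreasing_seqP => k; apply: le_trans (Eg k).
  by rewrite lerDl mulr_ge0// ltW.
have Ecvg : cvgn E.
  by apply: nonincreasing_is_cvgn Edec _; exists l => _ [k _ <-].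
have diff0 : (fun k => c^-1 * (E k - E k.+1)) @ \oo --> (0 : R).
  rewrite -[X in _ --> X](mulr0 c^-1); apply: cvgMl_tmp.
  rewrite -(subrr (lim (E @ \oo))); apply: cvgB => //.
  by rewrite cvg_shiftS.
apply: squeeze_cvgr diff0; last exact: cvg_cst.
apply: nearW => k; rewrite g0 /= -(ler_pM2l c0) mulVKf ?gt_eqF//.
by have := Eg k; lra.
Qed.

Theorem corollary4 (R : realType) (m n : nat) (hm : (0 < m)%N) (hmn : (m <= n)%N)
    (f : 'M[R]_(m, n) -> R) (L mu eps : R) (xstar x0 : 'M[R]_(m, n))
    (hproper : proper_fun f)
    (hL : 0 < L) (hsmooth : Lsmooth L f)
    (hmin : global_minimizer f xstar)
    (hmin_uniq : forall z, global_minimizer f z -> z = xstar)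
    (hmu : 0 < mu) (hPL : global_PL mu (f xstar) f)
    (heps : 0 < eps) :
  exists (bbar : R) (abar : R -> R),
    [/\ 0 < bbar < 1,
        forall beta, 0 <= beta < bbar -> 0 < abar beta &
        forall beta alpha, 0 <= beta < bbar -> 0 < alpha < abar beta ->
          [/\ frob_bounded (muesterov_x f eps alpha beta x0),
              frob_bounded (muesterov_y f eps alpha beta x0) &
              (fun k => frob_norm
                 (frob_grad f (muesterov_y f eps alpha beta x0 k))) @ \oo
                --> (0 : R)]].
Proof.
have [D xD] : exists D, forall x, f x <= f x0 -> frob_norm x <= D.
  have [D KD] := compact_frob_bounded (hproper _ (@segment_compact _ (f xstar) (f x0))).
  by exists D => x fx; apply: KD; rewrite /= in_itv /= fx hmin.
(* [M] bounds the gradient at every [y] that the energy bound allows.  It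
   depends on neither [alpha] nor [beta], so the threshold for [beta] can be
   chosen from it without circularity. *)
pose C := eps / 8; have C0 : 0 < C by rewrite divr_gt0.
pose gap := f x0 - f xstar; have gap0 : 0 <= gap by rewrite subr_ge0 hmin.
pose rho := Num.sqrt (gap / C).
pose M := frob_norm (frob_grad f 0) + L * (D + rho).
pose s := Num.sqrt (M ^+ 2 + eps ^+ 2).
have s0 : 0 < s by rewrite sqrtr_gt0 ltr_wpDl ?sqr_ge0// exprn_gt0.
have Cs0 : 0 < 4 * C + s by rewrite addr_gt0// mulr_gt0.
exists (C / (4 * C + s)), (fun=> Num.min 1 (eps / (4 * L))); split.
- by rewrite divr_gt0//= ltr_pdivrMr// mul1r; lra.
- by move=> beta _; rewrite lt_min ltr01 divr_gt0// mulr_gt0.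
move=> beta alpha /andP[b0 bb] /andP[a0]; rewrite lt_min => /andP[a1 aL].
have bC : beta * (4 * C + s) <= C by rewrite -ler_pdivlMr// ltW.
have b1 : beta <= 1.
  rewrite -(ler_pM2r Cs0) mul1r (le_trans bC)//; lra.
have b2C : beta ^+ 2 * (4 * C + s) <= C.
  by rewrite (le_trans _ bC)// ler_pM2r// expr2 ler_piMl.
pose x := muesterov_x f eps alpha beta x0.
pose y := muesterov_y f eps alpha beta x0.
pose d k := x k - (muesterov f eps alpha beta x0 k).1.
pose G k := frob_grad f (y k).
pose P k := invmx (spd_sqrt (G k *m (G k)^T + (eps ^+ 2)%:M)) *m G k.
have yE k : y k = x k + beta *: d k.
  by rewrite /y /d /x /muesterov_y /muesterov_x; case: muesterov.
have xS k : x k.+1 = y k - alpha *: P k by exact: muesterov_xES.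
have dS k : d k.+1 = x k.+1 - x k.
  by rewrite /d /x /muesterov_x /=; case: muesterov.
pose E k := f (x k) + C / alpha * frob_norm (d k) ^+ 2.
have Ca0 : 0 < C / alpha by rewrite divr_gt0.
have Ef k : f (x k) <= E k by rewrite lerDl mulr_ge0 ?sqr_ge0// (ltW Ca0).
have local_bounds k : E k <= f x0 ->
    [/\ frob_norm (x k) <= D, frob_norm (y k) <= D + rho & frob_norm (G k) <= M].
  move=> Ek; have xk := xD _ (le_trans (Ef k) Ek).
  (* This is where [alpha < 1] is used: the energy bounds the displacement
     only by a multiple of [alpha]. *)
  have dk : frob_norm (d k) <= rho.
    rewrite -(ler_pXn2r (n := 2))// ?nnegrE ?frob_norm_ge0 ?sqrtr_ge0//.
    rewrite /rho [X in _ <= X]sqr_sqrtr; last by rewrite divr_ge0 ?(ltW C0).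
    rewrite ler_pdivlMr// mulrC.
    have : C / alpha * frob_norm (d k) ^+ 2 <= gap.
      by move: Ek; rewrite /E /gap; have := hmin (x k); lra.
    apply: le_trans; rewrite ler_wpM2r ?sqr_ge0//.
    by rewrite ler_pdivlMr// ler_piMr ?(ltW C0) ?(ltW a1).
  have yk : frob_norm (y k) <= D + rho.
    rewrite yE (le_trans (frob_norm_triangle _ _))// lerD// frob_normZ ger0_norm//.
    by rewrite (le_trans _ dk)// ler_piMl ?frob_norm_ge0.
  split=> //; rewrite -(subrK (frob_grad f 0) (G k)) (le_trans (frob_norm_triangle _ _))//.
  rewrite /M addrC lerD2l (le_trans (hsmooth.2 _ _))// subr0.
  by rewrite ler_wpM2l ?(ltW hL).
have descent k : E k <= f x0 ->
    frob_dot (G k) (G k) <= s * frob_dot (G k) (P k) /\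
    E k.+1 + alpha / 4 * frob_dot (G k) (P k) <= E k.
  move=> Ek; have [_ _ Gk] := local_bounds k Ek.
  have GP : frob_dot (G k) (G k) <= s * frob_dot (G k) (P k).
    apply: precond_dot_lower => //; first exact: ltW.
    rewrite sqr_sqrtr ?addr_ge0 ?sqr_ge0// lerD2r -frob_norm_sqr.
    rewrite ler_pXn2r ?nnegrE ?frob_norm_ge0//; exact: le_trans (frob_norm_ge0 _) Gk.
  split=> //; rewrite /E dS.
  have := @energy_step _ _ _ f L eps s alpha beta (x k) (d k) (P k).
  rewrite /= -yE -xS; apply => //; first exact: ltW.
  exact: precond_norm_le.
have GP0 k : 0 <= frob_dot (G k) (P k) by exact: precond_dot_ge0.
have Ele k : E k <= f x0.
  elim: k => [|k IH].
    rewrite /E /d /x /muesterov_x /= subrr /frob_norm /frob_dot mulmx0 mxtrace0.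
    by rewrite sqrtr0 expr0n /= mulr0 addr0.
  have [_ dec] := descent k IH; apply: le_trans IH; apply: le_trans dec.
  by rewrite lerDl mulr_ge0// divr_ge0// ltW.
split.
- by exists D => k; have [] := local_bounds k (Ele k).
- by exists (D + rho) => k; have [] := local_bounds k (Ele k).
have G2 : (fun k => frob_dot (G k) (G k)) @ \oo --> (0 : R).
  apply: (@cvg0_of_energy _ E _ (alpha / (4 * s)) (f xstar)).
  - by rewrite divr_gt0// mulr_gt0.
  - by move=> k; exact: frob_dot_ge0.
  - by move=> k; exact: le_trans (hmin _) (Ef k).
  move=> k; have [GP dec] := descent k (Ele k); apply: le_trans dec.
  rewrite lerD2l invfM -!mulrA !ler_pM2l ?invr_gt0// ler_pdivrMl//.
rewrite -sqrtr0; apply: continuous_cvg G2; exact: sqrt_continuous.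
Qed.
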